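(* Let $$\varLambda=\{(u+v\sqrt2,\;u-v\sqrt2):u,v\in\mathbb{Z}\}\subset\mathbb{R}^2.$$ Let $c>0$ and let $P^*_\rho$ be the image under the support mapping of the Poisson point process $P_\rho$ in $\mathbb{R}^2$ with intensity measure $\rho=\sum_{e\in\varLambda}c\,\delta_e$. Let $\varepsilon>0$ be small enough that the balls $B_\varepsilon(e)$, $e\in\varLambda$, are pairwise disjoint, let $P$ be an arbitrary simple point process in $\mathbb{R}^2$, and let $P_{\boldsymbol b}$ be the image of $P$ under the mapping $\boldsymbol b$. Then the cluster processes $\psi_{\mathscr{D}_S}(P^*_\rho)$ and $\psi_{\mathscr{D}_S}(P_{\boldsymbol b})$, i.e. the images of $P^*_\rho$ and $P_{\boldsymbol b}$ under $$\psi_{\mathscr{D}_S}(\eta)=\sum_{X\in\mathfrak{X}_1,\ (X,\eta)\in\mathscr{D}_S}\delta_X ,$$ are random $1$-dimensional cluster tessellations (random cluster tessellations in $\mathbb{R}$).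
   Context: Point processes. $\mathscr{M}^{\bullet}(\mathbb{R}^2)$ is the set of locally finite simple counting measures on $\mathbb{R}^2$, identified with locally finite subsets $\eta\subset\mathbb{R}^2$, with the $\sigma$-algebra generated by the counting functions $\eta\mapsto\eta(B)$, $B$ bounded Borel. A simple point process in $\mathbb{R}^2$ is a probability measure on $\mathscr{M}^{\bullet}(\mathbb{R}^2)$. The Poisson point process $P_\rho$ with locally finite intensity measure $\rho$ has independent numbers of points in disjoint bounded Borel sets, the number in $B$ being Poisson distributed with parameter $\rho(B)$. For $\rho=\sum_{e\in\varLambda}c\,\delta_e$ its realizations have the form $\eta=\sum_{e\in\varLambda}k_e(\eta)\delta_e$ with $k_e(\eta)\in\{0,1,2,\dots\}$, and the support mapping is $\operatorname{supp}(\eta)=\sum_{e\in\varLambda,\ k_e(\eta)\ne0}\delta_e$. The mapping $\boldsymbol b$. $B_\varepsilon(e)$ is the closed ball of radius $\varepsilon$ centred at $e$. For $\eta\in\mathscr{M}^{\bullet}(\mathbb{R}^2)$ and $e\in\varLambda$, let $p_e(\eta)$ be the barycentre $\frac{1}{\operatorname{card}(\eta\cap B_\varepsilon(e))}\sum_{f\in\eta\cap B_\varepsilon(e)}f$ if $\eta\cap B_\varepsilon(e)\ne\emptyset$, and $p_e(\eta)=e$ otherwise; $\boldsymbol b(\eta)=\sum_{e\in\varLambda}\delta_{p_e(\eta)}$. Clusters. $\mathfrak{X}_1=\{X\subset\mathbb{R}:\operatorname{card}(X)<\infty\}$ is the space of clusters in $\mathbb{R}$, with the $\sigma$-algebra generated,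 analogously, by the counting functions $X\mapsto\operatorname{card}(X\cap B)$. $\mathscr{M}^{\bullet}(\mathfrak{X}_1)$ is the set of locally finite cluster configurations, i.e. sets of clusters (written as sums of Dirac measures) such that only finitely many of the clusters meet any given bounded set, with the $\sigma$-algebra generated by the counting functions. A cluster process is a probability measure on $\mathscr{M}^{\bullet}(\mathfrak{X}_1)$. Tessellations. $\langle X\rangle$ is the convex hull of $X$. A cluster $X$ is a discrete polytope if for every $a\in X$ there is a supporting hyperplane $H$ of $\langle X\rangle$ with $H\cap\langle X\rangle=\{a\}$ (equivalently, $X$ is the vertex set of $\langle X\rangle$; in $\mathbb{R}$, a two-point set is the discrete polytope of a compact interval). A collection of discrete polytopes in $\mathscr{M}^{\bullet}(\mathfrak{X}_1)$ is a cluster tessellation if the convex hulls of its clusters form a locally finite face-to-face tiling, where face-to-face means only that whenever two tiles intersect, they intersect in whole faces (a common face of both); the tiles need not cover $\mathbb{R}$. A random cluster tessellation is a cluster process concentrated on the set of cluster tessellations. The property $\mathscr{D}_S$. Let $\pi,\pi^*:\mathbb{R}^2\to\mathbb{R}$ be the projections onto the first and second coordinate, and $W=\{e\in\mathbb{R}^2:\pi^*(e)\in[-\tfrac1{\sqrt2},\tfrac1{\sqrt2}]\}$. A pair $(X,\eta)\in\mathfrak{X}_1\times\mathscr{M}^{\bullet}(\mathbb{R}^2)$ belongs to $\mathscr{D}_S$ if and only if: (i) $\operatorname{card}X=2$; (ii) $X=\{a=\pi(e_1),b=\pi(e_2)\}$ with $e_1\ne e_2$ in $\eta\cap W$; (iii)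 the open interval between $a$ and $b$ does not meet $\pi(\eta\cap W)$. *)

(* Defs.v *)
From HB Require Import structures.
From mathcomp Require Import all_boot all_order all_algebra finmap.
From mathcomp Require Import all_classical all_reals all_analysis.
From mathcomp Require Import measurable_realfun.
Set Implicit Arguments.
Unset Strict Implicit.
Unset Printing Implicit Defensive.
Import Order.TTheory GRing.Theory Num.Theory.
Import numFieldNormedType.Exports.
Local Open Scope classical_set_scope.
Local Open Scope ring_scope.

(* Generators of the sigma-algebra generated by the functions [f i], [i \in I]. *)
Definition preimages_of (T V : Type) (R : realType) (I : set V)
    (f : V -> T -> \bar R) : set (set T) :=
  \bigcup_(i in I) preimage_set_system setT (f i) measurable.

(* Borel subsets of the plane are the measurable sets of the product
   sigma-algebra on [R * R]; [bounded_set] refers to the maximum norm, which has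
   the same bounded sets as the Euclidean norm. *)
Definition bounded_borel (R : realType) : set (set (R * R)) :=
  [set B : set (R * R) | bounded_set B /\ measurable B].

Record simple_config (R : realType) := SimpleConfig {
  points :> set (R * R) ;
  points_locally_finite :
    forall B : set (R * R), bounded_set B -> finite_set (points `&` B) }.

Lemma set0_locally_finite (R : realType) (B : set (R * R)) :
  bounded_set B -> finite_set (set0 `&` B).
Proof. by rewrite set0I. Qed.

HB.instance Definition _ (R : realType) := gen_eqMixin (simple_config R).
HB.instance Definition _ (R : realType) := gen_choiceMixin (simple_config R).
HB.instance Definition _ (R : realType) :=
  isPointed.Build (simple_config R) (SimpleConfig (@set0_locally_finite R)).

Definition simple_space (R : realType) := g_sigma_algebraType
  (preimages_of (@bounded_borel R)
     (fun B (eta : simple_config R) => counting (eta `&` B) : \bar R)).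

(* Multiplicities are allowed: [k_e(eta)] is [eta [set e]]. *)
Record counting_measure (R : realType) := CountingMeasure {
  mass :> {measure set (R * R) -> \bar R} ;
  mass_nat : forall B, bounded_borel B -> exists n : nat, mass B = n%:R%:E }.

Lemma mzero_nat (R : realType) (B : set (R * R)) :
  bounded_borel B -> exists n : nat, (@mzero _ _ R B = n%:R%:E)%E.
Proof. by exists 0%N. Qed.

HB.instance Definition _ (R : realType) := gen_eqMixin (counting_measure R).
HB.instance Definition _ (R : realType) := gen_choiceMixin (counting_measure R).
HB.instance Definition _ (R : realType) :=
  isPointed.Build (counting_measure R) (CountingMeasure (@mzero_nat R)).

Definition counting_space (R : realType) := g_sigma_algebraType
  (preimages_of (@bounded_borel R)
     (fun B (eta : counting_measure R) => eta B)).

(* The second argument of the library's [poisson_prob] is not used.  At rate 0,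
   [poisson_prob] is the Dirac measure at 0 (unlike [poisson_pmf]). *)
Definition is_poisson_process (R : realType)
    (rho : {measure set (R * R) -> \bar R})
    (P : probability (counting_space R) R) : Prop :=
  (forall (B : set (R * R)) (n : nat), bounded_borel B ->
     P [set eta : counting_space R | eta B = n%:R%:E] =
     poisson_prob (fine (rho B)) 0 [set n]) /\
  (forall (m : nat) (B : 'I_m -> set (R * R)) (k : 'I_m -> nat),
     (forall i, bounded_borel (B i)) -> trivIset setT B ->
     P [set eta : counting_space R | forall i, eta (B i) = (k i)%:R%:E] =
     (\prod_(i < m) P [set eta : counting_space R | eta (B i) = (k i)%:R%:E])%E).

Definition Lambda (R : realType) : set (R * R) :=
  [set e | exists u v : int,
     e = (u%:~R + v%:~R * Num.sqrt 2, u%:~R - v%:~R * Num.sqrt 2)].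

Definition supp (R : realType) (eta : counting_measure R) : set (R * R) :=
  [set e | Lambda e /\ eta [set e] != 0%E].

Definition cball (R : realType) (eps : R) (e : R * R) : set (R * R) :=
  [set f | Num.sqrt ((f.1 - e.1) ^+ 2 + (f.2 - e.2) ^+ 2) <= eps].

Definition barycentre (R : realType) (A : set (R * R)) : R * R :=
  (#|` fset_set A|%:R)^-1 *: \sum_(f \in A) f.

Definition p_ (R : realType) (eps : R) (eta : set (R * R)) (e : R * R) : R * R :=
  if eta `&` cball eps e == set0 then e else barycentre (eta `&` cball eps e).

Definition b_ (R : realType) (eps : R) (eta : set (R * R)) : set (R * R) :=
  [set p_ eps eta e | e in @Lambda R].

Definition finite_subset (R : realType) : Type := {fset R}.

HB.instance Definition _ (R : realType) := Choice.on (finite_subset R).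
HB.instance Definition _ (R : realType) :=
  isPointed.Build (finite_subset R) (fset0 : {fset R}).

Definition to_set (R : realType) (X : finite_subset R) : set R :=
  [set` (X : {fset R})].

Definition cluster (R : realType) := g_sigma_algebraType
  (preimages_of [set B : set R | bounded_set B /\ measurable B]
     (fun B (X : finite_subset R) => counting (to_set X `&` B) : \bar R)).

Record cluster_config (R : realType) := ClusterConfig {
  clusters :> set (cluster R) ;
  clusters_locally_finite : forall B : set R, bounded_set B ->
    finite_set (clusters `&` [set X | to_set X `&` B !=set0]) }.

Lemma set0_clusters_locally_finite (R : realType) (B : set R) : bounded_set B ->
  finite_set (set0 `&` [set X : cluster R | to_set X `&` B !=set0]).
Proof. by rewrite set0I. Qed.

HB.instance Definition _ (R : realType) := gen_eqMixin (cluster_config R).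
HB.instance Definition _ (R : realType) := gen_choiceMixin (cluster_config R).
HB.instance Definition _ (R : realType) := isPointed.Build (cluster_config R)
  (ClusterConfig (@set0_clusters_locally_finite R)).

(* [A] ranges over all measurable sets of clusters, so the counts may be [+oo]. *)
Definition cluster_space (R : realType) := g_sigma_algebraType
  (preimages_of (@measurable _ (cluster R))
     (fun A (Phi : cluster_config R) => counting (Phi `&` A) : \bar R)).

Definition conv_hull (R : realType) (X : set R) : set R :=
  \bigcap_(A in [set A : set (convex_lmodType R^o) | convex_set A /\ X `<=` A]) A.

(* Hyperplanes of the line are the level sets of nonzero linear forms
   [x |-> u * x], i.e. single points. *)
Definition supporting_hyperplane (R : realType) (K H : set R) : Prop :=
  exists u t : R, [/\ u != 0, H = [set x | u * x = t],
    K `<=` [set x | u * x <= t] & H `&` K !=set0].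

Definition discrete_polytope (R : realType) (X : set R) : Prop :=
  forall a, X a -> exists H, supporting_hyperplane (conv_hull X) H /\
    H `&` conv_hull X = [set a].

(* Nonempty faces of [K], including [K] itself. *)
Definition face (R : realType) (K F : set R) : Prop :=
  F = K \/ exists H, supporting_hyperplane K H /\ F = H `&` K.

Definition tiles (R : realType) (Phi : set (cluster R)) : set (set R) :=
  [set conv_hull (to_set X) | X in Phi].

(* The tiles need not cover the line. *)
Definition cluster_tessellation (R : realType) (Phi : set (cluster R)) : Prop :=
  [/\ forall X, Phi X -> discrete_polytope (to_set X),
      forall B : set R, bounded_set B ->
        finite_set (tiles Phi `&` [set K | K `&` B !=set0]) &
      forall K L, tiles Phi K -> tiles Phi L -> K `&` L !=set0 ->
        face K (K `&` L) /\ face L (K `&` L)].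

Definition random_cluster_tessellation (R : realType)
    (Q : probability (cluster_space R) R) : Prop :=
  {ae Q, forall Phi : cluster_space R, cluster_tessellation Phi}.

Definition window (R : realType) : set (R * R) :=
  [set e | - (Num.sqrt 2)^-1 <= e.2 <= (Num.sqrt 2)^-1].

Definition D_S (R : realType) (X : cluster R) (eta : set (R * R)) : Prop :=
  #|` (X : {fset R})| = 2%N /\
  exists e1 e2 : R * R,
    [/\ (eta `&` @window R) e1 /\ (eta `&` @window R) e2, e1 != e2,
        (X : {fset R}) = [fset e1.1; e2.1]%fset &
        forall e, (eta `&` @window R) e ->
          ~ (Num.min e1.1 e2.1 < e.1 < Num.max e1.1 e2.1)].

Definition psi_D_S (R : realType) (eta : set (R * R)) : set (cluster R) :=
  [set X | D_S X eta].

(* Main.v *)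
Require Import Defs.
From HB Require Import structures.
From mathcomp Require Import all_boot all_order all_algebra finmap.
From mathcomp Require Import all_classical all_reals all_analysis.
From mathcomp Require Import measurable_realfun.
From mathcomp Require Import ring lra.
Set Implicit Arguments.
Unset Strict Implicit.
Unset Printing Implicit Defensive.
Import Order.TTheory GRing.Theory Num.Theory.
Import numFieldNormedType.Exports.
Local Open Scope classical_set_scope.
Local Open Scope ring_scope.

(** The configuration [psi_D_S eta] is a tessellation for every locally finite
    simple eta, hence almost surely for both processes.  Write Z for the
    projection to the line of the points of eta in the window.  As eta is
    locally finite and the window has bounded height, Z is locally finite, and [psi_D_S eta] is the set [gaps Z] of the pairs of consecutive
    points of Z ([psi_D_SE]).  Intervals between consecutive points never
    overlap, so they form a face-to-face tiling.

    The remaining issue is measurability, both of the three maps and of an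
    event of cluster configurations on which the tessellation property can be
    certified.

    All the maps are handled by one principle, [measurable_counting_enum]: if a
    random set is enumerated without repetition by countably many measurable
    points, each present on a measurable event, then its cardinality is a
    countable sum of indicators, hence measurable.  The supports and the images
    under [b_] are enumerated by the lattice; for [b_] the repetitions are
    excluded because each barycentre stays in its own ball, and the barycentre
    is measurable because sums over the points of eta are integrals against a
    kernel ([ge0_measurable_sum_points]).  The gaps of Z are enumerated by the
    rationals: a rational q outside Z with points of Z on both sides lies in the
    gap whose endpoints are the last point of Z before q and the first one after
    q; these depend measurably on eta, as comparing them with a real number
    amounts to asking whether Z hits an interval.  Each gap is charged to the
    rational of least rank that it contains.

    The certifying event is [noncrossing]: all clusters are pairs, and for each
    rational q at most one cluster has points on both sides of q.  It is
    measurable as a countable intersection of counting events, it contains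
    every [gaps Z], and it consists of tessellations, since two intervals with
    overlapping interiors would straddle a common rational. *)

(** * Sigma-algebras generated by counts, and countable enumerations *)

Lemma measurable_preimages_of_fun (T : pointedType) (V : Type) (R : realType)
    (I : set V) (f : V -> T -> \bar R) (i : V) : I i ->
  measurable_fun setT (f i : g_sigma_algebraType (preimages_of I f) -> \bar R).
Proof.
move=> Ii _ B mB; apply: sub_sigma_algebra; exists i => //.
by exists B.
Qed.

Lemma measurable_to_preimages_of d (S : measurableType d) (T : pointedType)
    (V : Type) (R : realType) (I : set V) (f : V -> T -> \bar R)
    (h : S -> g_sigma_algebraType (preimages_of I f)) :
  (forall i, I i -> measurable_fun setT (fun x => f i (h x))) ->
  measurable_fun setT h.
Proof.
have E : @measurable _ (g_sigma_algebraType (preimages_of I f)) =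
  <<s preimages_of I f >> by [].
move=> mfh; apply: (@measurability _ _ _ _ _ _ _ E) => //.
move=> _ [_ [i Ii [B mB <-]] <-].
rewrite setTI.
exact: mfh.
Qed.

(** Equipotence covers the infinite case, where both counts are [+oo]. *)
Lemma counting_card_eq (V W : choiceType) (R : realType) (A : set V)
    (B : set W) : (A #= B)%card -> counting A = counting B :> \bar R.
Proof.
move=> AB; rewrite /counting; have [fA|iA] := pselect (finite_set A).
  have [n An] := fA.
  have fB : finite_set B by rewrite -(eq_finite_set AB).
  rewrite !asboolT//; congr (_%:R%:E).
  rewrite (card_fset_set An) (@card_fset_set _ _ n)//.
  by apply: card_eq_trans An; rewrite card_eq_sym.
by rewrite !asboolF//; rewrite -(eq_finite_set AB).
Qed.

Lemma counting_neq0 (V : choiceType) (R : realType) (A : set V) :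
  (counting A != 0 :> \bar R)%E <-> A !=set0.
Proof.
split=> [|[x Ax]].
  have [->|/set0P//] := eqVneq A set0.
  by rewrite /counting asboolT ?fset_set0 ?eqxx.
rewrite /counting; case: asboolP => // fA.
rewrite eqe pnatr_eq0 cardfs_eq0; apply/eqP => A0.
by have := in_fset_set fA x; rewrite A0 inE mem_set.
Qed.

Lemma counting_le1 (V : choiceType) (R : realType) (A : set V) :
  (counting A <= 1 :> \bar R)%E <-> (forall x y, A x -> A y -> x = y).
Proof.
split=> [|A1].
  rewrite /counting; case: asboolP => // fA; rewrite lee_fin lern1.
  move=> cA x y Ax Ay; apply/eqP; apply: contraTT cA => xy; rewrite -ltnNge.
  rewrite -[leqLHS](_ : #|` [fset x; y]%fset| = _); last by rewrite cardfs2 xy.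
  apply: fsubset_leq_card; apply/fsubsetP => z.
  by rewrite !inE => /orP[] /eqP ->; rewrite in_fset_set// mem_set.
have [[x Ax]|] := pselect (A !=set0).
  have -> : A = [set x] by apply/seteqP; split=> [y Ay|y ->//]; exact: A1.
  by rewrite /counting asboolT// fset_set1 cardfs1.
move=> /set0P/negP/negPn/eqP ->.
by rewrite /counting asboolT// fset_set0 lee_fin.
Qed.

(** The count at x is the number of indices i with [K i x]; as the indices are
    countable, this is a countable sum of indicators
    of the measurable events [K i]. *)
Lemma measurable_counting_enum d (S : measurableType d) (R : realType)
    (V : choiceType) (I : countType) (K : I -> set S) (f : I -> S -> V)
    (N : S -> set V) :
  (forall i, measurable (K i)) ->
  (forall x i j, K i x -> K j x -> f i x = f j x -> i = j) ->
  (forall x, N x = [set f i x | i in [set i | K i x]]) ->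
  measurable_fun setT (fun x => counting (N x) : \bar R).
Proof.
move=> mK finj NE.
pose P x := [set choice.pickle i | i in [set i | K i x]].
have cP x : counting (N x) = (\sum_(0 <= n <oo) \d_n (P x))%E :> \bar R.
  rewrite -counting_dirac NE; apply: (@counting_card_eq _ _ R).
  apply: (card_eq_trans (B := [set i | K i x])).
    apply: inj_card_eq => i j; rewrite !inE => Ki Kj; exact: finj.
  rewrite card_eq_sym; apply: inj_card_eq => i j _ _.
  exact: (pcan_inj choice.pickleK).
under eq_fun do rewrite cP.
apply: (@ge0_emeasurable_sum _ _ _ _ (fun n x => \d_n (P x)) xpredT) => // n _.
rewrite (_ : (fun x => _) = (fun x => (\1_[set x | P x n] x)%:E)); last first.
  apply/funext => x; rewrite diracE indicE.
  by rewrite (_ : (x \in _) = (n \in P x))//; apply/idP/idP; rewrite !inE.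
apply/measurable_EFinP; apply: measurable_indic.
have [[i <-]|ni] := pselect (exists i : I, choice.pickle i = n).
  rewrite (_ : [set x | _] = K i)//; apply/seteqP; split => x /=.
    by move=> [j Kj /(pcan_inj choice.pickleK) <-].
  by exists i.
rewrite (_ : [set x | _] = set0)//; apply/seteqP; split => x //=.
by move=> [j _ jn]; apply: ni; exists j.
Qed.

(** * Bounded sets of the plane and the lattice *)

Lemma bounded_setP (R : realType) (V : normedModType R) (B : set V) :
  bounded_set B <-> exists2 M : R, 0 < M & forall x, B x -> `|x| <= M.
Proof.
split=> [[M [Mr MB]]|[M M0 MB]].
  exists (Num.max M 0 + 1); first by rewrite ltr_wpDl// le_max lexx orbT.
  by apply: MB; rewrite ltr_pwDr// le_max lexx.
exists M; split; first exact: gtr0_real.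
by move=> N MN x /MB /le_trans; apply; exact: ltW.
Qed.

Lemma prod_norm_le (R : realType) (e : R * R) (M : R) :
  (`|e| <= M) = (`|e.1| <= M) && (`|e.2| <= M).
Proof. by rewrite prod_normE ge_max. Qed.

Lemma bounded_borel_setX (R : realType) (A B : set R) :
  bounded_set A -> bounded_set B -> measurable A -> measurable B ->
  bounded_borel (A `*` B).
Proof.
move=> /bounded_setP[M M0 MA] /bounded_setP[N N0 NB] mA mB; split.
  apply/bounded_setP; exists (Num.max M N); first by rewrite lt_max M0.
  move=> e [/MA e1 /NB e2].
  by rewrite prod_norm_le !le_max e1 e2 orbT.
exact: measurableX.
Qed.

Lemma bounded_borel_set1 (R : realType) (e : R * R) : bounded_borel [set e].
Proof.
have -> : [set e] = [set e.1] `*` [set e.2].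
  by apply/seteqP; split => [x ->//|[x y] [/= -> ->]]; case: (e).
apply: bounded_borel_setX => //.
  by apply/bounded_setP; exists (`|e.1| + 1) => [|x ->]; rewrite ?ltr_wpDl// lerDl.
by apply/bounded_setP; exists (`|e.2| + 1) => [|x ->]; rewrite ?ltr_wpDl// lerDl.
Qed.

Section Lattice.
Variable R : realType.
Implicit Types (w : int * int) (B : set (R * R)).

Definition lattice_pt w : R * R :=
  (w.1%:~R + w.2%:~R * Num.sqrt 2, w.1%:~R - w.2%:~R * Num.sqrt 2).

Lemma LambdaE : @Lambda R = range lattice_pt.
Proof.
apply/seteqP; split => [e [u [v ->]]|_ [[u v] _ <-]]; last by exists u, v.
by exists (u, v).
Qed.

(** The sum and the difference of the two coordinates of a lattice point are 2 u
    and 2 v sqrt 2, so a bound on the point bounds both integers; this makes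
    the lattice locally finite. *)
Lemma lattice_pt_norm_ge w :
  `|w.1%:~R| <= `|lattice_pt w| /\ `|w.2%:~R| <= `|lattice_pt w|.
Proof.
set x : R := w.1%:~R; set y : R := w.2%:~R; set s : R := Num.sqrt 2.
have := lexx `|lattice_pt w|; rewrite {1}prod_norm_le /= -/x -/y -/s.
set M := `|lattice_pt w| => /andP[h1 h2].
have s1 : 1 <= s by rewrite -sqrtr1 ler_sqrt// ler1n.
have xM : `|x + x| <= M + M.
  have -> : x + x = (x + y * s) + (x - y * s) by ring.
  by rewrite (le_trans (ler_normD _ _))// lerD.
have yM : `|y * s + y * s| <= M + M.
  have -> : y * s + y * s = (x + y * s) - (x - y * s) by ring.
  by rewrite (le_trans (ler_normB _ _))// lerD.
split.
  by move: xM; rewrite -!mulr2n normrMn ler_pMn2r.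
move: yM; rewrite -!mulr2n normrMn ler_pMn2r// normrM (ger0_norm (le_trans _ s1))//.
by apply: le_trans; rewrite ler_peMr.
Qed.

Lemma lattice_pt_inj : injective lattice_pt.
Proof.
move=> [u v] [u' v'] [h1 h2].
have s0 : Num.sqrt 2 != 0 :> R by rewrite gt_eqF// sqrtr_gt0.
have uu' : u = u'.
  by apply/eqP; rewrite -(eqr_int R); apply/eqP; lra.
move: h1; rewrite uu' => /addrI/(mulIf s0)/eqP.
by rewrite eqr_int => /eqP ->.
Qed.

Lemma finite_lattice_box (M : R) :
  finite_set [set w | `|lattice_pt w| <= M].
Proof.
have fI : finite_set [set z : int | `|z%:~R : R| <= M].
  pose I := [set n%:Z | n in `I_(Num.bound M).+1].
  have fI : finite_set I by apply: finite_image; exact: finite_II.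
  apply: (@sub_finite_set _ _ (I `|` [set - z | z in I])); last first.
    by rewrite finite_setU; split=> //; exact: finite_image.
  move=> z /= zM.
  have zb : (`|z| < (Num.bound M).+1)%N.
    rewrite -(ltr_nat R) (le_lt_trans (y := M))//.
      by rewrite -[leLHS]/((`|z|%N : int)%:~R) abszE intr_norm.
    have M0 : 0 <= M by exact: le_trans zM.
    by rewrite (lt_trans (archi_boundP M0))// ltr_nat.
  by case: (intP z) zb => [|n|n] zb; [left|left|right];
    [exists 0%N|exists n.+1|exists n.+1%:Z => //; exists n.+1].
pose J := [set z : int | `|z%:~R : R| <= M].
apply: (@sub_finite_set _ _ (J `*` J)); last exact: finite_setX.
move=> w wM; have [w1 w2] := lattice_pt_norm_ge w.
by split; [exact: le_trans w1 wM|exact: le_trans w2 wM].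
Qed.

End Lattice.

(** * Support and barycentre mappings into locally finite sets *)

Lemma Lambda_locally_finite (R : realType) (B : set (R * R)) :
  bounded_set B -> finite_set (@Lambda R `&` B).
Proof.
move=> /bounded_setP[M M0 BM]; rewrite LambdaE.
apply: sub_finite_set (finite_image (@lattice_pt R) (finite_lattice_box M)).
by move=> _ [[w _ <-] /BM ?]; exists w.
Qed.

Lemma measurable_counting_points (R : realType) (B : set (R * R)) :
  bounded_borel B ->
  measurable_fun setT (fun eta : simple_space R => counting (eta `&` B) : \bar R).
Proof.
move=> bB.
exact: (@measurable_preimages_of_fun _ _ R (@bounded_borel R)
  (fun B (eta : simple_config R) => counting (eta `&` B) : \bar R) B).
Qed.

Lemma supp_locally_finite (R : realType) (eta : counting_measure R)
    (B : set (R * R)) : bounded_set B -> finite_set (supp eta `&` B).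
Proof.
move=> /Lambda_locally_finite; apply: sub_finite_set => e [[Le _] Be].
by split.
Qed.

Definition supp_config (R : realType) (eta : counting_space R) :
  simple_space R := SimpleConfig (@supp_locally_finite R eta).

(** The supports are enumerated by the lattice points, each one present on the
    event that its singleton has nonzero mass; lattice singletons are bounded
    Borel sets, so these events belong to the generating sigma-algebra. *)
Lemma measurable_supp_config (R : realType) :
  measurable_fun setT (@supp_config R).
Proof.
apply: measurable_to_preimages_of => B bB /=.
apply: (measurable_counting_enum
  (S := counting_space R)
  (K := fun w => [set eta : counting_space R |
    B (lattice_pt R w) /\ eta [set lattice_pt R w] != 0%E])
  (f := fun w _ => lattice_pt R w) (N := fun eta => supp eta `&` B)).
- move=> w; have [Bw|nBw] := pselect (B (lattice_pt R w)); last first.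
    by rewrite (_ : [set _ | _] = set0)//; apply/seteqP; split => // ? [].
  rewrite (_ : [set _ | _] =
    setT `&` [set eta : counting_space R | eta [set lattice_pt R w] != 0%E]).
    apply: emeasurable_neq => //.
    apply: (@measurable_preimages_of_fun _ _ R (@bounded_borel R)
      (fun B (eta : counting_measure R) => eta B)).
    exact: bounded_borel_set1.
  by apply/seteqP; split => x /= [].
- by move=> _ w w' _ _ /lattice_pt_inj.
- move=> eta; apply/seteqP; split => [e [[]]|_ [w [Bw ew] <-]].
    by rewrite LambdaE => -[w _ <-] ew Bw; exists w.
  by split=> //; split=> //; rewrite LambdaE; exists w.
Qed.

Section Ball.
Variables (R : realType) (eps : R).
Hypothesis eps_gt0 : 0 < eps.

Lemma cballE (e f : R * R) :
  cball eps e f = ((f.1 - e.1) ^+ 2 + (f.2 - e.2) ^+ 2 <= eps ^+ 2) :> Prop.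
Proof.
rewrite /cball /= -{1}(ger0_norm (ltW eps_gt0)) -(sqrtr_sqr eps).
by rewrite ler_sqrt// sqr_ge0.
Qed.

Lemma cball_coord_le (e f : R * R) : cball eps e f ->
  `|f.1 - e.1| <= eps /\ `|f.2 - e.2| <= eps.
Proof.
have le_eps (x y : R) : x ^+ 2 + y ^+ 2 <= eps ^+ 2 -> `|x| <= eps.
  move=> h; rewrite -(ler_pXn2r (n := 2))// ?nnegrE// ?(ltW eps_gt0)//.
  by rewrite real_normK ?num_real//; have := sqr_ge0 y; lra.
rewrite cballE => h; split; [exact: le_eps h|].
by apply: (@le_eps _ (f.1 - e.1)); rewrite addrC.
Qed.

Lemma bounded_borel_cball (e : R * R) : bounded_borel (cball eps e).
Proof.
split.
  apply/bounded_setP; exists (`|e| + eps); first by rewrite ltr_wpDl.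
  move=> f /cball_coord_le[h1 h2].
  have /andP[e1 e2] : (`|e.1| <= `|e|) && (`|e.2| <= `|e|).
    by rewrite -prod_norm_le.
  rewrite prod_norm_le; apply/andP; split.
    rewrite -[f.1](subrK e.1) addrC; apply: (le_trans (ler_normD _ _)).
    exact: lerD.
  rewrite -[f.2](subrK e.2) addrC; apply: (le_trans (ler_normD _ _)).
  exact: lerD.
rewrite (_ : cball eps e = setT `&` (fun f =>
  (f.1 - e.1) ^+ 2 + (f.2 - e.2) ^+ 2 <= eps ^+ 2) @^-1` [set true]).
  apply: measurable_fun_ler => //; apply: measurable_funD.
    by apply: measurable_funX; apply: measurable_funB.
  by apply: measurable_funX; apply: measurable_funB.
by rewrite setTI; apply/seteqP; split => f; rewrite cballE.
Qed.

Lemma barycentre_coord (A : set (R * R)) : finite_set A ->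
  barycentre A =
  (#|` fset_set A|%:R^-1 * \sum_(f <- fset_set A) f.1,
   #|` fset_set A|%:R^-1 * \sum_(f <- fset_set A) f.2).
Proof.
move=> fA; rewrite /barycentre fsbig_finite//=.
by congr (_ * _, _ * _); apply: (big_morph _ (id1 := 0) (op1 := +%R)).
Qed.

(** Jensen's inequality for the squared distance m1^2 + m2^2 of the barycentre to
    e: the tangent inequality x^2 >= 2 m x - m^2 is summed over the points of A,
    in both coordinates. *)
Lemma barycentre_cball (A : set (R * R)) (e : R * R) : finite_set A ->
  A !=set0 -> A `<=` cball eps e -> cball eps e (barycentre A).
Proof.
move=> fA A0 Ae; rewrite barycentre_coord// cballE /=.
set n := #|` fset_set A|; set p1 := _ * _; set p2 := _ * _.
have n0 : 0 < n%:R :> R.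
  rewrite ltr0n lt0n cardfs_eq0; apply/eqP => AE.
  have [f Af] := A0; have := in_fset_set fA f.
  by rewrite AE inE mem_set.
have np1 : n%:R * p1 = \sum_(f <- fset_set A) f.1.
  by rewrite mulrA divff ?mul1r// gt_eqF.
have np2 : n%:R * p2 = \sum_(f <- fset_set A) f.2.
  by rewrite mulrA divff ?mul1r// gt_eqF.
pose m1 := p1 - e.1; pose m2 := p2 - e.2; rewrite -/m1 -/m2.
(* summed tangent inequality, at the displacement (m1, m2) of the barycentre *)
have : \sum_(f <- fset_set A) (2 * m1 * (f.1 - e.1) + 2 * m2 * (f.2 - e.2)) <=
       \sum_(f <- fset_set A) (eps ^+ 2 + m1 ^+ 2 + m2 ^+ 2).
  rewrite big_seq [leRHS]big_seq; apply: ler_sum => f.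
  rewrite in_fset_set// inE => /Ae; rewrite cballE.
  have := sqr_ge0 (f.1 - e.1 - m1); have := sqr_ge0 (f.2 - e.2 - m2).
  by nra.
rewrite big_split/= -!mulr_sumr !sumrB -np1 -np2.
rewrite !big_const_seq !iter_addr_0 !count_predT -/n.
rewrite -[(_ + _ + _) *+ _]mulr_natl -[e.1 *+ _]mulr_natl -[e.2 *+ _]mulr_natl.
have -> : 2 * m1 * (n%:R * p1 - n%:R * e.1) + 2 * m2 * (n%:R * p2 - n%:R * e.2)
  = n%:R * (2 * m1 ^+ 2 + 2 * m2 ^+ 2) by rewrite /m1 /m2; ring.
by rewrite ler_pM2l//; lra.
Qed.

Lemma p_cball (eta : simple_config R) (e : R * R) : cball eps e (p_ eps eta e).
Proof.
rewrite /p_; case: eqVneq => [_|/set0P A0].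
  by rewrite cballE !subrr expr0n addr0 sqr_ge0.
apply: barycentre_cball => //.
by apply: points_locally_finite; case: (bounded_borel_cball e).
Qed.

(** The point [p_ eps eta e] is within eps of e, so only lattice points near B
    contribute to B. *)
Lemma b_locally_finite (eta : simple_config R) (B : set (R * R)) :
  bounded_set B -> finite_set (b_ eps eta `&` B).
Proof.
move=> /bounded_setP[M M0 BM].
have /Lambda_locally_finite fL : bounded_set [set e : R * R | `|e| <= M + eps].
  by apply/bounded_setP; exists (M + eps) => //; rewrite ltr_wpDl// ltW.
apply: sub_finite_set (finite_image (p_ eps eta) fL).
move=> _ [[e Le <-] /BM]; rewrite prod_norm_le => /andP[p1 p2].
exists e => //; split=> //=; have [h1 h2] := cball_coord_le (p_cball eta e).
rewrite prod_norm_le; apply/andP; split.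
  rewrite -[e.1](subKr (p_ eps eta e).1); apply: (le_trans (ler_normB _ _)).
  exact: lerD.
rewrite -[e.2](subKr (p_ eps eta e).2); apply: (le_trans (ler_normB _ _)).
exact: lerD.
Qed.

End Ball.

(** * Measurability of the barycentre mapping *)

Section SumPoints.
Variables (R : realType) (A : set (R * R)).
Hypothesis bA : bounded_borel A.

Let pts (eta : simple_space R) : seq (R * R) := fset_set (eta `&` A).

Let fin_pts (eta : simple_space R) : finite_set (eta `&` A).
Proof. by apply: points_locally_finite; case: bA. Qed.

Let empirical (eta : simple_space R) : {measure set (R * R) -> \bar R} :=
  msum (fun i => \d_(nth 0 (pts eta) i)) (size (pts eta)).

Let empiricalE (eta : simple_space R) (U : set (R * R)) :
  empirical eta U = counting (eta `&` (A `&` U)).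
Proof.
rewrite setIA /empirical /= /msum /counting.
have fU : finite_set (eta `&` A `&` U).
  apply: sub_finite_set (fin_pts eta) => x []; by [].
rewrite asboolT// card_fset_sum1.
rewrite -(big_mkord xpredT (fun i => \d_(nth 0 (pts eta) i) U)).
rewrite -(big_nth 0 xpredT (fun f : R * R => \d_f U)) natr_sum -sumEFin.
rewrite -[RHS]fsbig_finite//= [RHS]fsbig_mkcondr [RHS]fsbig_finite//=.
by apply: eq_bigr => f _; rewrite diracE; case: ifP.
Qed.

(** The sum is the integral of g against the measure [empirical eta].  The masses
    of this measure are counts of points in bounded Borel sets, so it is a
    kernel, and integrals against a kernel are measurable. *)
Lemma ge0_measurable_sum_points (g : R * R -> R) :
  (forall f, 0 <= g f) -> measurable_fun setT g ->
  measurable_fun setT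
    (fun eta : simple_space R => \sum_(f <- fset_set (eta `&` A)) g f).
Proof.
move=> g0 mg; apply/measurable_EFinP.
rewrite (_ : _ \o _ = fun eta => (\int[empirical eta]_f (g f)%:E)%E).
  apply: measurable_fun_integral_kernel.
  - move=> U mU; have /funext -> := empiricalE ^~ U.
    apply: measurable_counting_points; split; last first.
      by have [_ mA] := bA; exact: measurableI.
    have [[M [Mr MA]] _] := bA; exists M; split => // N /MA AN x [/AN].
    by [].
  - by move=> f; rewrite lee_fin.
  - exact/measurable_EFinP.
apply/funext => eta /=; rewrite /empirical ge0_integral_measure_sum//; first last.
- exact/measurable_EFinP.
- by move=> f _; rewrite lee_fin.
rewrite (big_nth 0) big_mkord -sumEFin; apply: eq_bigr => i _.
by rewrite integral_dirac ?diracT ?mul1e//; exact/measurable_EFinP.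
Qed.

Lemma measurable_sum_points (g : R * R -> R) :
  measurable_fun setT g ->
  measurable_fun setT
    (fun eta : simple_space R => \sum_(f <- fset_set (eta `&` A)) g f).
Proof.
move=> mg.
rewrite (_ : (fun _ => _) = fun eta : simple_space R =>
    \sum_(f <- fset_set (eta `&` A)) Num.max (g f) 0 -
    \sum_(f <- fset_set (eta `&` A)) Num.max (- g f) 0).
  apply: measurable_funB; apply: ge0_measurable_sum_points => //.
  - by move=> f; rewrite le_max lexx orbT.
  - exact: measurable_maxr.
  - by move=> f; rewrite le_max lexx orbT.
  - by apply: measurable_maxr => //; exact: measurableT_comp.
apply/funext => eta; rewrite -sumrB; apply: eq_bigr => f _.
by rewrite !maxElt; case: ltgtP => h; case: ltgtP => h'; lra.
Qed.
End SumPoints.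


Section BMap.
Variables (R : realType) (eps : R).
Hypothesis eps_gt0 : 0 < eps.

(** The barycentre is a quotient of sums over the points in the ball.  Its
    denominator enters as a real power, which is a measurable function even
    across 0; the empty ball is a separate case. *)
Lemma measurable_p (e : R * R) :
  measurable_fun setT (fun eta : simple_space R => p_ eps eta e).
Proof.
have bC := bounded_borel_cball eps_gt0 e.
pose N (eta : simple_space R) : \bar R := counting (eta `&` cball eps e).
have mN : measurable_fun setT N by exact: measurable_counting_points.
pose coord (g : R * R -> R) (eta : simple_space R) := if N eta == 0%E then g e
  else fine (N eta) `^ (-1) * \sum_(f <- fset_set (eta `&` cball eps e)) g f.
have mcoord g : measurable_fun setT g -> measurable_fun setT (coord g).
  move=> mg; apply: measurable_fun_ifT => //.
    exact: measurable_fun_eqe.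
  apply: measurable_funM; last exact: measurable_sum_points.
  apply: (measurableT_comp (measurable_powR _)).
  exact: measurableT_comp.
rewrite (_ : (fun eta => _) = fun eta : simple_space R =>
  (coord fst eta, coord snd eta)).
  by apply: measurable_fun_pair; exact: mcoord.
apply/funext => eta; rewrite /coord /p_ -/(N eta).
have fA : finite_set (eta `&` cball eps e).
  by apply: points_locally_finite; case: bC.
case: eqVneq => [A0|/set0P A0].
  by rewrite /N A0 /counting asboolT// fset_set0 eqxx; case: (e).
rewrite (negbTE (_ : N eta != 0%E)); last exact/counting_neq0.
rewrite barycentre_coord// /N /counting asboolT//=.
by rewrite powR_inv1.
Qed.

Definition b_config (eta : simple_space R) : simple_space R :=
  SimpleConfig (b_locally_finite eps_gt0 eta).

(** The balls being disjoint and [p_ eps eta e] lying in the ball of e, distinct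
    lattice points give distinct points of the image. *)
Lemma measurable_b_config : trivIset (@Lambda R) (cball eps) ->
  measurable_fun setT b_config.
Proof.
move=> disj; apply: measurable_to_preimages_of => B bB /=.
apply: (measurable_counting_enum (S := simple_space R)
  (K := fun w => (fun eta : simple_space R => p_ eps eta (lattice_pt R w))
                   @^-1` B)
  (f := fun w (eta : simple_space R) => p_ eps eta (lattice_pt R w))
  (N := fun eta => b_ eps eta `&` B)).
- move=> w; rewrite -[X in measurable X]setTI; apply: measurable_p => //.
  by case: bB.
- move=> eta w w' _ _ pp; apply: (@lattice_pt_inj R); apply: disj.
  + by rewrite LambdaE; exists w.
  + by rewrite LambdaE; exists w'.
  + exists (p_ eps eta (lattice_pt R w)); split; first exact: p_cball.
    by rewrite pp; exact: p_cball.
- move=> eta; apply/seteqP; split => [_ [[e Le <-] Be]|_ [w Bw <-]].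
    by move: Le Be; rewrite LambdaE => -[w _ <-] Bw; exists w.
  by split=> //; exists (lattice_pt R w) => //; rewrite LambdaE; exists w.
Qed.

End BMap.

(** * Consecutive points of a locally finite set of reals *)

Section Gaps.
Variable R : realType.
Implicit Types (Z : set R) (a b q z : R).

Definition locally_finite Z := forall B, bounded_set B -> finite_set (Z `&` B).

Definition consecutive Z a b :=
  [/\ Z a, Z b, a < b & forall z, Z z -> ~ (a < z < b)].

Definition gaps Z : set (Defs.cluster R) :=
  [set X | exists a b, consecutive Z a b /\ X = [fset a; b]%fset].

Definition pred_pt Z q := sup (Z `&` `]-oo, q[).

(** The reflection of [pred_pt], so that its properties follow by symmetry. *)
Definition succ_pt Z q := - pred_pt (-%R @` Z) (- q).

Lemma finite_set_max (A : set R) : finite_set A -> A !=set0 ->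
  exists2 m, A m & ubound A m.
Proof.
move=> fA [x0 Ax0].
have x0A : x0 \in fset_set A by rewrite in_fset_set// mem_set.
case: (@Order.TotalTheory.arg_maxP _ _ _ [` x0A]%fset xpredT val) => // i _ imax.
exists (val i); first by have := fsvalP i; rewrite in_fset_set// inE.
move=> y Ay; have yA : y \in fset_set A by rewrite in_fset_set// mem_set.
exact: (imax [` yA]%fset).
Qed.

Lemma sup_max (A : set R) m : A m -> ubound A m -> sup A = m.
Proof.
move=> Am uAm; apply/le_anti/andP; split; first by apply: ge_sup => //; exists m.
by apply: ub_le_sup => //; exists m.
Qed.

Lemma pred_ptP Z q : locally_finite Z -> (Z `&` `]-oo, q[) !=set0 ->
  [/\ Z (pred_pt Z q), pred_pt Z q < q &
      forall z, Z z -> z < q -> z <= pred_pt Z q].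
Proof.
move=> fZ [z0 [Zz0]]; rewrite /= in_itv/= => z0q.
have bI : bounded_set [set` `[z0, q[].
  apply/bounded_setP; exists (`|z0| + `|q| + 1); first by rewrite ltr_wpDl// addr_ge0.
  move=> z; rewrite /= in_itv/= => /andP[z0z zq].
  rewrite ler_norml; have := ler_norm q; have := ler_norm (- z0); rewrite normrN.
  have := normr_ge0 q; have := normr_ge0 z0; lra.
have [|m [Zm]] := finite_set_max (fZ _ bI).
  by exists z0; split=> //; rewrite /= in_itv/= lexx.
rewrite /= in_itv/= => /andP[z0m mq] mub.
have ubm z : Z z -> z < q -> z <= m.
  move=> Zz zq; have [z0z|zz0] := leP z0 z; last exact: le_trans (ltW zz0) z0m.
  by apply: mub; split=> //; rewrite /= in_itv/= z0z.
have -> : pred_pt Z q = m.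
  apply: sup_max; first by split=> //; rewrite /= in_itv.
  by move=> z [Zz]; rewrite /= in_itv/=; exact: ubm.
by [].
Qed.

Lemma locally_finiteN Z : locally_finite Z -> locally_finite (-%R @` Z).
Proof.
move=> fZ B /bounded_setP[M M0 BM].
have bB : bounded_set (-%R @` B).
  by apply/bounded_setP; exists M => // _ [x /BM xM <-]; rewrite normrN.
apply: sub_finite_set (finite_image -%R (fZ _ bB)).
by move=> _ [[z Zz <-] Bz]; exists z => //; split=> //; exists (- z); rewrite ?opprK.
Qed.

Lemma succ_ptP Z q : locally_finite Z -> (Z `&` `]q, +oo[) !=set0 ->
  [/\ Z (succ_pt Z q), q < succ_pt Z q &
      forall z, Z z -> q < z -> succ_pt Z q <= z].
Proof.
move=> /locally_finiteN fZ [z0 [Zz0]]; rewrite /= in_itv/= andbT => qz0.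
have [|h1 h2 h3] := pred_ptP (q := - q) fZ.
  by exists (- z0); split; [exists z0|rewrite /= in_itv/= ltrN2].
split.
- by have [z Zz E] := h1; rewrite /succ_pt -E opprK.
- by rewrite /succ_pt ltrNr.
- by move=> z Zz qz; rewrite /succ_pt lerNl; apply: h3; [exists z|rewrite ltrN2].
Qed.

Lemma pred_pt_consecutive Z a b q : consecutive Z a b -> a < q <= b ->
  pred_pt Z q = a.
Proof.
move=> [Za Zb ab gap] /andP[aq qb]; apply: sup_max.
  by split=> //; rewrite /= in_itv.
move=> z [Zz]; rewrite /= in_itv/= => zq; rewrite leNgt; apply/negP => az.
by apply: (gap _ Zz); rewrite az (lt_le_trans zq).
Qed.

Lemma succ_pt_consecutive Z a b q : consecutive Z a b -> a <= q < b ->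
  succ_pt Z q = b.
Proof.
move=> [Za Zb ab gap] /andP[aq qb].
apply/(canLR (@opprK _)); apply: (@pred_pt_consecutive _ _ (- a)).
  split; [by exists b|by exists a|by rewrite ltrN2|].
  move=> _ [z Zz <-]; rewrite !ltrN2 andbC; exact: gap.
by rewrite ltrN2 lerN2 qb aq.
Qed.

Lemma consecutive_pred_succ Z q : locally_finite Z -> ~ Z q ->
  (Z `&` `]-oo, q[) !=set0 -> (Z `&` `]q, +oo[) !=set0 ->
  consecutive Z (pred_pt Z q) (succ_pt Z q).
Proof.
move=> fZ nZq /(pred_ptP fZ)[Zp pq pmax] /(succ_ptP fZ)[Zs qs smin].
split=> //; first exact: lt_trans pq qs.
move=> z Zz /andP[pz zs]; have [zq|qz|zq] := ltgtP z q.
- by have := pmax _ Zz zq; rewrite leNgt pz.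
- by have := smin _ Zz qz; rewrite leNgt zs.
- by apply: nZq; rewrite -zq.
Qed.

Lemma fset2_inj a b a' b' : a < b -> a' < b' ->
  [fset a; b]%fset = [fset a'; b']%fset -> a = a' /\ b = b'.
Proof.
move=> ab ab' /fsetP E.
have := E b; have := E a; rewrite !inE !eqxx ?orbT.
move=> /esym/orP[/eqP aE|/eqP aE] /esym/orP[/eqP bE|/eqP bE].
- by rewrite aE bE ltxx in ab.
- by [].
- by move: ab; rewrite aE bE => /(lt_trans ab'); rewrite ltxx.
- by rewrite aE bE ltxx in ab.
Qed.

(** A pair of consecutive points meeting B has an endpoint in B, which determines
    the other endpoint; and Z has finitely many points in B. *)
Lemma gaps_locally_finite Z : locally_finite Z ->
  forall B : set R, bounded_set B ->
  finite_set (gaps Z `&` [set X | to_set X `&` B !=set0]).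
Proof.
move=> fZ B bB.
apply: (@sub_finite_set _ _
  ((fun a => [fset a; succ_pt Z a]%fset : Defs.cluster R) @` (Z `&` B) `|`
   (fun b => [fset pred_pt Z b; b]%fset : Defs.cluster R) @` (Z `&` B))); last first.
  by rewrite finite_setU; split; apply: finite_image; exact: fZ.
move=> _ [[a [b [cab ->]]] [z [zX Bz]]].
have [Za Zb ab _] := cab; move: zX; rewrite /to_set /= !inE => /orP[/eqP za|/eqP zb].
  left; exists a; first by rewrite -za in Bz *; split=> //; rewrite za.
  by rewrite (succ_pt_consecutive cab)// lexx.
right; exists b; first by rewrite -zb in Bz *; split=> //; rewrite zb.
by rewrite (pred_pt_consecutive cab)// lexx andbT.
Qed.

End Gaps.

(** * Neighbours of a point in a random locally finite set *)

Section RandomGaps.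
Context d (S : measurableType d) (R : realType).

(** The count of [fset f x; g x] in B is computed by enumeration by the two
    labels, the second one being discarded when the two points coincide. *)
Lemma measurable_fset2 (f g : S -> R) :
  measurable_fun setT f -> measurable_fun setT g ->
  measurable_fun setT (fun x => [fset f x; g x]%fset : Defs.cluster R).
Proof.
move=> mf mg; apply: measurable_to_preimages_of => B [_ mB] /=.
apply: (measurable_counting_enum
  (K := fun i : bool => if i then f @^-1` B
        else g @^-1` B `&` [set x | g x != f x])
  (f := fun (i : bool) x => if i then f x else g x)
  (N := fun x => to_set ([fset f x; g x]%fset : Defs.cluster R) `&` B)).
- move=> [|]; first by rewrite -[X in measurable X]setTI; exact: mf.
  apply: measurableI; first by rewrite -[X in measurable X]setTI; exact: mg.
  rewrite (_ : [set _ | _] = setT `&` (fun x => g x == f x) @^-1` [set false]).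
    exact: measurable_fun_eqr.
  by rewrite setTI; apply/seteqP; split=> x /= => [/negbTE|/negbT].
- by move=> x [|] [|]//= => [_ [_ /eqP gf] /esym|[_ /eqP gf] _].
- move=> x; apply/seteqP; split=> [y [/=]|_ [[] /= Ki <-]].
  + rewrite /to_set /= !inE; have [->|yf] := eqVneq y (f x).
      by exists true.
    by move=> /= /eqP yg By; exists false; rewrite /= -?yg.
  + by split=> //; rewrite /to_set /= !inE eqxx.
  + by case: Ki => Bg _; split=> //; rewrite /to_set /= !inE eqxx orbT.
Qed.

(** Measurability of a random set of reals, expressed by hitting events because
    the projection of eta hits B exactly if eta has a point in the part of the
    window above B, which is a counting event. *)
Definition random_set (Y : S -> set R) := forall B : set R,
  bounded_set B -> measurable B -> measurable [set x | Y x `&` B !=set0].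

Lemma random_set_hit (Y : S -> set R) (B : set R) : random_set Y ->
  measurable B -> measurable [set x | Y x `&` B !=set0].
Proof.
move=> mY mB.
rewrite (_ : [set x | _] =
  \bigcup_n [set x | Y x `&` (B `&` `[- n%:R, n%:R]) !=set0]).
  apply: bigcupT_measurable => n; apply: mY; last exact: measurableI.
  apply/bounded_setP; exists (n%:R + 1) => [|z [_]]; first by rewrite ltr_wpDl.
  by rewrite /= in_itv/= ler_norml => /andP[? ?]; lra.
apply/seteqP; split=> x /=; last first.
  by move=> [n _ [z [Yz [Bz _]]]]; exists z.
move=> [z [Yz Bz]]; exists (Num.bound `|z|) => //; exists z; split=> //; split=> //.
rewrite /= in_itv/= -ler_norml; apply/ltW; exact: archi_boundP.
Qed.

Lemma random_setN (Y : S -> set R) : random_set Y ->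
  random_set (fun x => -%R @` Y x).
Proof.
move=> mY B bB mB.
rewrite (_ : [set x | _] = [set x | Y x `&` (-%R @^-1` B) !=set0]).
  apply: mY.
    move/bounded_setP : bB => [M M0 BM]; apply/bounded_setP; exists M => // z /BM.
    by rewrite normrN.
  by rewrite -[X in measurable X]setTI; exact: oppr_measurable.
apply/seteqP; split=> x /=.
  by move=> [_ [[z Yz <-] Bz]]; exists z.
by move=> [z [Yz Bz]]; exists (- z); split=> //; exists z.
Qed.

(** The supremum below q exceeds y exactly if the set hits the interval from y to
    q.  When the set has no point below q, the supremum of the empty set is 0 by
    convention, which adds the second event when y < 0. *)
Lemma measurable_pred_pt (Y : S -> set R) q :
  (forall x, locally_finite (Y x)) -> random_set Y ->
  measurable_fun setT (fun x => pred_pt (Y x) q).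
Proof.
move=> fY mY; apply: (measurability _ (RGenOInfty.measurableE R)) => //.
move=> _ [_ [y ->] <-]; rewrite setTI.
rewrite (_ : _ @^-1` _ = [set x | Y x `&` `]y, q[ !=set0] `|`
  (if y < 0 then ~` [set x | Y x `&` `]-oo, q[ !=set0] else set0)).
  apply: measurableU; first exact: random_set_hit.
  by case: ifP => // _; apply: measurableC; exact: random_set_hit.
apply/seteqP; split=> x /=; rewrite in_itv/= andbT.
  have [Y0|Y0] := pselect (Y x `&` `]-oo, q[ !=set0).
    have [Yp pq _] := pred_ptP (fY x) Y0 => yp; left.
    by exists (pred_pt (Y x) q); split=> //; rewrite /= in_itv/= yp pq.
  rewrite /pred_pt (_ : _ `&` _ = set0) ?sup0 => [y0|]; first by right; rewrite y0.
  by apply/seteqP; split=> // z Yz; apply: Y0; exists z.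
case=> [[z [Yz]]|]; first rewrite /= in_itv/= => /andP[yz zq].
  apply: (lt_le_trans yz); have [|_ _] := @pred_ptP _ (Y x) q (fY x); last exact.
  by exists z; split.
case: ifP => // y0 Y0; rewrite /pred_pt (_ : _ `&` _ = set0) ?sup0//.
by apply/seteqP; split=> // z Yz; apply: Y0; exists z.
Qed.

Lemma measurable_succ_pt (Y : S -> set R) q :
  (forall x, locally_finite (Y x)) -> random_set Y ->
  measurable_fun setT (fun x => succ_pt (Y x) q).
Proof.
move=> fY mY; rewrite /succ_pt; apply: measurableT_comp => //.
apply: measurable_pred_pt => [x|]; first exact: locally_finiteN.
exact: random_setN.
Qed.

End RandomGaps.

(** * Measurability of the gaps of a random locally finite set *)

Section GapsMeasurable.
Context d (S : measurableType d) (R : realType).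
Variable Z : S -> set R.
Hypotheses (fZ : forall x, locally_finite (Z x)) (mZ : random_set Z).

Let rank (q : rat) : nat := choice.pickle q.

Let rank_inj : injective rank.
Proof. exact: (pcan_inj choice.pickleK). Qed.

Let gap_at (q : rat) (x : S) : Defs.cluster R :=
  [fset pred_pt (Z x) (ratr q); succ_pt (Z x) (ratr q)]%fset.

Let in_gap (q r : rat) : set S :=
  [set x | pred_pt (Z x) (ratr q) < ratr r < succ_pt (Z x) (ratr q)].

Let first_in_gap (q : rat) : set S :=
  [set x | Z x `&` `]-oo, ratr q[ !=set0] `&`
  [set x | Z x `&` `]ratr q, +oo[ !=set0] `&`
  ~` [set x | Z x `&` [set ratr q] !=set0] `&`
  \bigcap_r (if (rank r < rank q)%N then ~` in_gap q r else setT).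

Let measurable_in_gap q r : measurable (in_gap q r).
Proof.
rewrite (_ : in_gap q r =
  (fun x => pred_pt (Z x) (ratr q)) @^-1` `]-oo, ratr r[ `&`
  (fun x => succ_pt (Z x) (ratr q)) @^-1` `]ratr r, +oo[); last first.
  by apply/seteqP; split=> x /=; rewrite !in_itv/= andbT => /andP.
apply: measurableI; rewrite -[X in measurable X]setTI.
  exact: measurable_pred_pt.
exact: measurable_succ_pt.
Qed.

Let measurable_first_in_gap q : measurable (first_in_gap q).
Proof.
apply: measurableI; last first.
  rewrite -[X in measurable X]setCK setC_bigcap; apply: measurableC.
  apply: bigcupT_measurable_rat => r; apply: measurableC.
  by case: ifP => // _; exact: measurableC.
apply: measurableI; last by apply: measurableC; exact: random_set_hit.
by apply: measurableI; exact: random_set_hit.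
Qed.

Let first_in_gapP q x : first_in_gap q x ->
  consecutive (Z x) (pred_pt (Z x) (ratr q)) (succ_pt (Z x) (ratr q)) /\
  in_gap q q x.
Proof.
move=> [[[Zl Zr] nZq] _].
have nZ : ~ Z x (ratr q) by move=> h; apply: nZq; exists (ratr q).
split; first exact: consecutive_pred_succ.
have [_ h1 _] := pred_ptP (fZ x) Zl; have [_ h2 _] := succ_ptP (fZ x) Zr.
exact/andP.
Qed.

(** Enumeration by the rationals that are first in the gap containing them: the
    rank condition selects exactly one rational for each gap. *)
Lemma measurable_counting_gaps (A : set (Defs.cluster R)) : measurable A ->
  measurable_fun setT (fun x => counting (gaps (Z x) `&` A) : \bar R).
Proof.
move=> mA; apply: (measurable_counting_enum
  (K := fun q => first_in_gap q `&` gap_at q @^-1` A) (f := gap_at)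
  (N := fun x => gaps (Z x) `&` A)).
- move=> q; apply: measurableI => //; rewrite -[X in measurable X]setTI.
  apply: measurable_fset2 => //; first exact: measurable_pred_pt.
  exact: measurable_succ_pt.
- move=> x q r [Kq _] [Kr _].
  have [cq iq] := first_in_gapP Kq; have [cr ir] := first_in_gapP Kr.
  have [_ _ ltq _] := cq; have [_ _ ltr _] := cr.
  move=> /(fset2_inj ltq ltr)[pp ss].
  have nlt s t : first_in_gap s x -> in_gap s t x -> ~~ (rank t < rank s)%N.
    by move=> [_ /(_ t I)] + ist; case: ifP.
  apply: rank_inj; apply/anti_leq/andP; split; rewrite leqNgt; last first.
    by apply: nlt Kr _; rewrite /in_gap /= -pp -ss.
  by apply: nlt Kq _; rewrite /in_gap /= pp ss.
- move=> x; apply/seteqP; split=> [X [[a [b [cab ->]]] AX]|_ [q [Kq Aq] <-]].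
    have [Za Zb ab _] := cab.
    (* the least rank of a rational in the gap between a and b *)
    pose P n := `[< exists2 q : rat, a < ratr q < b & rank q = n >].
    have exP : exists n, P n.
      have [q /[!in_itv] qab] := rat_in_itvoo ab.
      by exists (rank q); apply/asboolP; exists q.
    case: (ex_minnP exP) => _ /asboolP[q /andP[aq qb] <-] qmin.
    have pE : pred_pt (Z x) (ratr q) = a.
      by apply: (pred_pt_consecutive cab); rewrite aq ltW.
    have sE : succ_pt (Z x) (ratr q) = b.
      by apply: (succ_pt_consecutive cab); rewrite qb ltW.
    exists q; last by rewrite /gap_at pE sE.
    split; last by rewrite /= /gap_at pE sE.
    split; first split; first split.
    + by exists a; split=> //; rewrite /= in_itv.
    + by exists b; split=> //; rewrite /= in_itv/= qb.
    + move=> [z [Zz /= zq]]; have [_ _ _ /(_ _ Zz)] := cab; apply.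
      by rewrite zq aq qb.
    + move=> r _; case: ifP => // rq; rewrite /in_gap /= pE sE => rab.
      have /qmin : P (rank r) by apply/asboolP; exists r.
      by rewrite leqNgt rq.
  split=> //; have [cq _] := first_in_gapP Kq.
  by exists (pred_pt (Z x) (ratr q)), (succ_pt (Z x) (ratr q)).
Qed.

End GapsMeasurable.

(** * The projected configuration and its pairs of consecutive points *)

Section Shadow.
Variable R : realType.
Implicit Types eta : simple_space R.

Let height : R := (Num.sqrt 2)^-1.

Definition shadow (A : set (R * R)) : set R := fst @` (A `&` @window R).

Let shadow_hit (A : set (R * R)) (B : set R) :
  shadow A `&` B !=set0 <-> A `&` (B `*` `[- height, height]) !=set0.
Proof.
split=> [[_ [[e [Ae We] <-] Be]]|[e [Ae [Be We]]]].
  by exists e; split=> //; split=> //=; rewrite in_itv.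
by exists e.1; split=> //; exists e => //; split=> //; move: We; rewrite /= in_itv.
Qed.

Let bounded_height : bounded_set [set` `[- height, height]].
Proof.
apply/bounded_setP; exists (`|height| + 1); first by rewrite ltr_wpDl.
move=> z; rewrite /= in_itv/= => /andP[h1 h2].
by rewrite ler_norml; have := ler_norm height; have := ler_norm (- height);
  rewrite normrN; lra.
Qed.

(** The window has bounded height, so the part of it above a bounded set of the
    line is bounded and contains finitely many points of eta. *)
Lemma shadow_locally_finite eta : locally_finite (shadow eta).
Proof.
move=> B bB.
have bBH : bounded_set (B `*` [set` `[- height, height]]).
  move/bounded_setP : bB => [M M0 BM].
  move/bounded_setP : bounded_height => [N N0 HN].
  apply/bounded_setP; exists (Num.max M N); first by rewrite lt_max M0.
  move=> e [/BM e1 /HN e2].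
  by rewrite prod_norm_le !le_max e1 e2 orbT.
apply: sub_finite_set (finite_image fst (points_locally_finite eta bBH)).
move=> _ [[e [Ae We] <-] Be]; exists e => //; split=> //; split=> //=.
Qed.

Lemma random_set_shadow : random_set (fun eta => shadow eta).
Proof.
move=> B bB mB.
rewrite (_ : [set _ | _] = setT `&` [set eta : simple_space R |
    (counting (eta `&` (B `*` `[- height, height])) : \bar R) != 0%E]).
  apply: emeasurable_neq => //; apply: measurable_counting_points.
  exact: bounded_borel_setX.
by rewrite setTI; apply/seteqP; split=> eta /=;
  [move=> /shadow_hit/counting_neq0|move=> /counting_neq0/shadow_hit]; apply.
Qed.

(** In [D_S] the two points of the plane are unordered and only distinct; as the
    cluster has two elements, their projections differ and can be ordered. *)
Lemma psi_D_SE (A : set (R * R)) : psi_D_S A = gaps (shadow A).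
Proof.
apply/seteqP; split=> X.
  move=> [cX [e1 [e2 [[e1A e2A] _ XE gap]]]].
  have ne : e1.1 != e2.1.
    by apply/eqP => E; move: cX; rewrite XE E cardfs2 eqxx.
  wlog lt12 : e1 e2 e1A e2A XE gap ne / e1.1 < e2.1 => [wh|].
    have [lt12|lt21|E] := ltgtP e1.1 e2.1; first exact: (wh e1 e2).
    - apply: (wh e2 e1) => //; first by rewrite XE fsetUC.
      + by move=> e; rewrite minC maxC; exact: gap.
      + by rewrite eq_sym.
    - by rewrite E eqxx in ne.
  exists e1.1, e2.1; split=> //; split=> //.
  - by exists e1.
  - by exists e2.
  - move=> _ [e Ae <-]; have := gap _ Ae.
    by rewrite (min_l (ltW lt12)) (max_r (ltW lt12)).
move=> [_ [_ [[[e1 e1A <-] [e2 e2A <-] lt12 gap] ->]]].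
split; first by rewrite cardfs2 lt_eqF.
exists e1, e2; split=> //.
  by apply: contraTneq lt12 => ->; rewrite ltxx.
move=> e Ae; rewrite (min_l (ltW lt12)) (max_r (ltW lt12)); apply: gap.
by exists e.
Qed.

Lemma psi_locally_finite eta (B : set R) : bounded_set B ->
  finite_set (psi_D_S eta `&` [set X | to_set X `&` B !=set0]).
Proof.
by rewrite psi_D_SE; apply: gaps_locally_finite; exact: shadow_locally_finite.
Qed.

Definition psi_config eta : cluster_space R :=
  ClusterConfig (@psi_locally_finite eta).

Lemma measurable_psi_config : measurable_fun setT psi_config.
Proof.
apply: measurable_to_preimages_of => A mA /=.
rewrite (_ : (fun _ => _) = fun eta => counting (gaps (shadow eta) `&` A)).
  apply: measurable_counting_gaps => //.
    exact: shadow_locally_finite.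
  exact: random_set_shadow.
by apply/funext => eta; rewrite psi_D_SE.
Qed.

End Shadow.

(** * Noncrossing cluster configurations are tessellations *)

Section Tilings.
Variable R : realType.
Implicit Types (X Y : Defs.cluster R) (Phi : cluster_space R) (a b q z : R).

Lemma conv_hull_pair a b : a <= b ->
  conv_hull (to_set ([fset a; b]%fset : Defs.cluster R)) = [set` `[a, b]].
Proof.
move=> ab; apply/seteqP; split=> [z|z zab A [cA XA]].
  apply; split=> [x y t|x]; last first.
    rewrite /to_set /= in_fset2 => /orP[] /eqP ->; by rewrite in_itv/= lexx ab.
  move=> /set_mem + /set_mem; rewrite /= !in_itv/= => /andP[ax xb] /andP[ay yb].
  apply/mem_set; rewrite /= in_itv/=.
  have convE : conv t x y = (t%:num * (x : R) + (1 - t%:num) * (y : R)) by [].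
  rewrite convE; have t0 : 0 <= t%:num by [].
  have t1 : t%:num <= 1 by [].
  by apply/andP; split; nra.
have Aa : A a by apply: XA; rewrite /to_set /= !inE eqxx.
have Ab : A b by apply: XA; rewrite /to_set /= !inE eqxx orbT.
move: zab; rewrite /= in_itv/= => /andP[az zb].
have [E|ltab] := eqVneq a b.
  by have -> : z = a by apply/le_anti; rewrite az E zb.
have ba0 : 0 < b - a by rewrite subr_gt0 lt_neqAle ltab.
have t0 : 0 <= (b - z) / (b - a) by rewrite divr_ge0 ?subr_ge0// ltW.
have t1 : (b - z) / (b - a) <= 1 by rewrite ler_pdivrMr// mul1r lerB.
have := cA a b (Itv01 t0 t1); rewrite !inE => /(_ Aa Ab).
have convE t :
  conv t (a : convex_lmodType R^o) b = t%:num * a + (1 - t%:num) * b by [].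
rewrite convE /=.
have -> // : (b - z) / (b - a) * a + (1 - (b - z) / (b - a)) * b = z.
by field; rewrite gt_eqF.
Qed.

Lemma supporting_left a b : a <= b ->
  supporting_hyperplane [set` `[a, b]] [set x | -1 * x = - a] /\
  [set x | -1 * x = - a] `&` [set` `[a, b]] = [set a].
Proof.
move=> ab; have aab : [set` `[a, b]] a by rewrite /= in_itv/= lexx.
split; last first.
  by apply/seteqP; split=> [x [/= + _]|_ ->] => [|]; [lra|split=> //=; lra].
exists (-1), (- a); split=> //.
- by move=> x; rewrite /= in_itv/= => /andP[]; lra.
- by exists a; split=> //=; lra.
Qed.

Lemma supporting_right a b : a <= b ->
  supporting_hyperplane [set` `[a, b]] [set x | 1 * x = b] /\
  [set x | 1 * x = b] `&` [set` `[a, b]] = [set b].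
Proof.
move=> ab; have bab : [set` `[a, b]] b by rewrite /= in_itv/= lexx ab.
split; last first.
  by apply/seteqP; split=> [x [/= + _]|_ ->] => [|]; [lra|split=> //=; lra].
exists 1, b; split=> //.
- by move=> x; rewrite /= in_itv/= => /andP[]; lra.
- by exists b; split=> //=; lra.
Qed.

Definition is_pair X := exists a b, a < b /\ X = [fset a; b]%fset.

Definition straddle q : set (Defs.cluster R) :=
  [set X | to_set X `&` `]-oo, q[ !=set0 /\ to_set X `&` `]q, +oo[ !=set0].

Lemma straddle_pair a b q : a < b ->
  straddle q ([fset a; b]%fset : Defs.cluster R) <-> a < q < b.
Proof.
move=> ab; split=> [[[x [xX xq]] [y [yX qy]]]|/andP[aq qb]].
  move: xX yX xq qy; rewrite /to_set /= !in_fset2 !in_itv/= andbT.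
  by move=> /orP[] /eqP -> /orP[] /eqP ->; lra.
split; [exists a|exists b]; rewrite /to_set /= !in_itv/= ?andbT; split=> //.
  by rewrite in_fset2 eqxx.
by rewrite in_fset2 eqxx orbT.
Qed.

(** Disjointness of the open intervals, tested at the rationals so that it becomes
    a countable intersection of counting events. *)
Definition noncrossing : set (cluster_space R) :=
  [set Phi | counting (Phi `&` [set X | #|` (X : {fset R})| != 2%N]) = 0%E
               :> \bar R] `&`
  \bigcap_(q : rat)
    [set Phi | (counting (Phi `&` straddle (ratr q)) <= 1 :> \bar R)%E].

Lemma noncrossing_pair Phi X : noncrossing Phi -> clusters Phi X -> is_pair X.
Proof.
move=> [/eqP P0 _] PX.
have cX : #|` (X : {fset R})| == 2%N.
  apply: contraTT P0 => cX; apply/counting_neq0.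
  by exists X.
have [x [y [xy XE]]] : exists x y : R, x != y /\ X = [fset x; y]%fset.
  have /fset0Pn[x xX] : (X : {fset R}) != fset0.
    by rewrite -cardfs_gt0 (eqP cX).
  have /cardfs1P[y yE] : #|` (X `\ x)%fset| == 1%N.
    by move: cX; rewrite (cardfsD1 x) xX.
  exists x, y; split; last by rewrite -yE fsetD1K.
  by have : y \in (X `\ x)%fset by [rewrite yE inE]; rewrite !inE eq_sym => /andP[].
have [lt|lt|E] := ltgtP x y.
- by exists x, y.
- by exists y, x; split=> //; rewrite XE fsetUC.
- by rewrite E eqxx in xy.
Qed.


(** If the open intervals met, a rational in their intersection would be straddled
    by both clusters, which would then be equal. *)
Lemma noncrossing_disjoint Phi a b c d : noncrossing Phi -> a < b -> c < d ->
  clusters Phi [fset a; b]%fset -> clusters Phi [fset c; d]%fset ->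
  [\/ b <= c, d <= a | a = c /\ b = d].
Proof.
move=> [_ ncr] ab cd Pab Pcd.
have [bc|cb] := leP b c; first by constructor 1.
have [da|ad] := leP d a; first by constructor 2.
have : Num.max a c < Num.min b d by rewrite gt_max !lt_min ab ad cb cd.
move=> /rat_in_itvoo[q]; rewrite in_itv/= gt_max lt_min.
move=> /andP[/andP[aq cq] /andP[qb qd]].
constructor 3; apply: fset2_inj => //.
have /counting_le1 := ncr q I; apply; split=> //; apply/straddle_pair => //.
  by rewrite aq qb.
by rewrite cq qd.
Qed.

Lemma pair_discrete_polytope a b : a < b ->
  discrete_polytope (to_set ([fset a; b]%fset : Defs.cluster R)).
Proof.
move=> ab z; rewrite /to_set /= in_fset2 => /orP[] /eqP ->.
  have [H E] := supporting_left (ltW ab).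
  by exists [set x | -1 * x = - a]; rewrite conv_hull_pair// ltW.
have [H E] := supporting_right (ltW ab).
by exists [set x | 1 * x = b]; rewrite conv_hull_pair// ltW.
Qed.

Lemma face_left a b : a <= b -> face [set` `[a, b]] [set a].
Proof.
move=> ab; right; have [H E] := supporting_left ab.
by exists [set x | -1 * x = - a].
Qed.

Lemma face_right a b : a <= b -> face [set` `[a, b]] [set b].
Proof.
move=> ab; right; have [H E] := supporting_right ab.
by exists [set x | 1 * x = b].
Qed.

Lemma itv_touch a b c : a <= b -> b <= c ->
  [set` `[a, b]] `&` [set` `[b, c]] = [set b].
Proof.
move=> ab bc; apply/seteqP; split=> [z|_ ->].
  rewrite /= !in_itv/= => -[/andP[_ zb] /andP[bz _]].
  by apply/le_anti; rewrite zb bz.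
by rewrite /= !in_itv/= !lexx ab bc.
Qed.

(** Local finiteness of the tiles does not reduce to that of the clusters, as a
    long interval meets [-M, M] without having an endpoint there; but such an
    interval straddles 0, and there is at most one.  For the faces, two tiles that
    meet are equal or share exactly one endpoint. *)
Lemma noncrossing_tessellation Phi : noncrossing Phi -> cluster_tessellation Phi.
Proof.
move=> nPhi.
have seg X : clusters Phi X -> exists a b, a < b /\ X = [fset a; b]%fset.
  exact: noncrossing_pair.
split.
- by move=> X /seg[a [b [ab ->]]]; exact: pair_discrete_polytope.
- move=> B /bounded_setP[M M0 BM].
  pose C := [set x : R | `|x| <= M].
  have bC : bounded_set C by apply/bounded_setP; exists M.
  pose h X := conv_hull (to_set X).
  apply: (@sub_finite_set _ _
    (h @` (clusters Phi `&` [set X | to_set X `&` C !=set0]) `|`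
     h @` (clusters Phi `&` straddle (ratr 0)))).
    move=> _ [[X PX <-] [z [zX /BM]]]; rewrite ler_norml => /andP[Mz zM].
    have [a [b [ab XE]]] := seg _ PX.
    have /andP[az zb] : a <= z <= b.
      by move: zX; rewrite XE (conv_hull_pair (ltW ab)) /= in_itv.
    have [aM|aM] := leP (- M) a.
      left; exists X => //.
      split=> //; exists a; split; first by rewrite XE /to_set /= in_fset2 eqxx.
      by rewrite /C /= ler_norml aM (le_trans az).
    have [bM|bM] := leP b M.
      left; exists X => //.
      split=> //; exists b; split; first by rewrite XE /to_set /= in_fset2 eqxx orbT.
      by rewrite /C /= ler_norml bM andbT (le_trans Mz).
    (* both endpoints are outside [-M, M] *)
    right; exists X => //.
    split=> //; rewrite XE; apply/straddle_pair => //; rewrite rmorph0.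
    by rewrite (lt_trans aM) ?oppr_lt0// (lt_trans M0).
  rewrite finite_setU; split; apply: finite_image.
    exact: clusters_locally_finite.
  have [_ /(_ 0 I)/counting_le1 P1] := nPhi.
  have [[X PX]|P0] := pselect ((clusters Phi `&` straddle (ratr 0)) !=set0).
    by apply: (sub_finite_set _ (finite_set1 X)) => Y PY; exact: P1.
  rewrite (_ : _ `&` _ = set0)//; apply/seteqP; split=> // X PX.
  by apply: P0; exists X.
- move=> _ _ [X PX <-] [Y PY <-].
  have [a [b [ab XE]]] := seg _ PX; have [c [d [cd YE]]] := seg _ PY.
  move: PX PY; rewrite XE YE !conv_hull_pair ?ltW// => PX PY [z [zab zcd]].
  have [bc|da|[<- <-]] := noncrossing_disjoint nPhi ab cd PX PY.
  + move: zab zcd; rewrite /= !in_itv/= => /andP[_ zb] /andP[cz _].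
    have E : b = c by apply/le_anti; rewrite bc (le_trans cz).
    rewrite -E itv_touch ?ltW// ?E//; split; last by apply: face_left; exact: ltW.
    by rewrite -E; apply: face_right; exact: ltW.
  + move: zab zcd; rewrite /= !in_itv/= => /andP[az _] /andP[_ zd].
    have E : d = a by apply/le_anti; rewrite da (le_trans az).
    rewrite setIC -E itv_touch ?ltW// ?E//; split; first by apply: face_left; exact: ltW.
    by rewrite -E; apply: face_right; exact: ltW.
  + by rewrite setIid; split; left.
Qed.

(** The generating counts only involve bounded B; the general case follows by
    exhausting B with bounded sets. *)
Lemma measurable_counting_cluster (B : set R) : measurable B ->
  measurable_fun setT
    (fun X : Defs.cluster R => counting (to_set X `&` B) : \bar R).
Proof.
move=> mB; pose F n := [set` `[- n%:R, n%:R]] : set R.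
have mbF n : bounded_set (B `&` F n).
  apply/bounded_setP; exists (n%:R + 1) => [|z [_]]; first by rewrite ltr_wpDl.
  by rewrite /F /= in_itv/= ler_norml => /andP[? ?]; apply/andP; split; lra.
apply: (@emeasurable_fun_cvg _ _ _ _
  (fun n (X : Defs.cluster R) => counting (to_set X `&` (B `&` F n)))).
  move=> n.
  apply: (@measurable_preimages_of_fun _ _ R
    [set B : set R | bounded_set B /\ measurable B]
    (fun B (X : finite_subset R) => counting (to_set X `&` B) : \bar R)).
  by split=> //; apply: measurableI => //; exact: measurable_itv.
move=> X _.
have fX A : finite_set (to_set X `&` A).
  exact/finite_setIl/finite_fset.
have mX A : measurable (to_set X `&` A).
  by apply: countable_measurable => //; exact: finite_set_countable.
have -> : to_set X `&` B = \bigcup_n (to_set X `&` (B `&` F n)).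
  apply/seteqP; split=> [z [Xz Bz]|z [n _ [Xz [Bz _]]]//].
  exists (Num.bound `|z|) => //; split=> //; split=> //.
  by rewrite /F /= in_itv/= -ler_norml; apply/ltW; exact: archi_boundP.
apply: (@nondecreasing_cvg_mu _ _ _ (@counting R R)).
- by move=> n; exact: mX.
- by apply: bigcupT_measurable => n; exact: mX.
- move=> m n mn; apply/subsetPset; do 2 apply: setIS.
  move=> z; rewrite /F /= !in_itv/= => /andP[h1 h2].
  by have : m%:R <= n%:R :> R; [rewrite ler_nat|move=> ?; apply/andP; split; lra].
Qed.

Lemma measurable_straddle q : measurable (straddle q).
Proof.
have hit (B : set R) : measurable B ->
    measurable [set X : Defs.cluster R | to_set X `&` B !=set0].
  move=> mB; rewrite (_ : [set _ | _] = setT `&`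
    [set X : Defs.cluster R | (counting (to_set X `&` B) : \bar R) != 0%E]).
    by apply: emeasurable_neq => //; exact: measurable_counting_cluster.
  rewrite setTI; apply/seteqP; split=> X /=; first by move=> /counting_neq0; apply.
  by move=> /counting_neq0.
by apply: measurableI; exact: hit.
Qed.

Lemma measurable_not_pair :
  measurable [set X : Defs.cluster R | #|` (X : {fset R})| != 2%N].
Proof.
rewrite (_ : [set _ | _] = setT `&`
  [set X : Defs.cluster R | (counting (to_set X `&` setT) : \bar R) != 2%:R%:E]).
  by apply: emeasurable_neq => //; exact: measurable_counting_cluster.
rewrite setTI; apply/seteqP; split=> X /=;
  rewrite setIT /counting asboolT ?set_fsetK ?eqe ?eqr_nat//; exact: finite_fset.
Qed.

Lemma measurable_noncrossing : measurable noncrossing.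
Proof.
have mc (A : set (Defs.cluster R)) : measurable A -> measurable_fun setT
    (fun Phi : cluster_space R => counting (Phi `&` A) : \bar R).
  exact: (@measurable_preimages_of_fun _ _ R (@measurable _ (Defs.cluster R))
    (fun A (Phi : cluster_config R) => counting (Phi `&` A) : \bar R)).
apply: measurableI.
  rewrite -[X in measurable X]setTI.
  exact: (mc _ measurable_not_pair measurableT _ (emeasurable_set1 0%E)).
rewrite -[X in measurable X]setCK setC_bigcap; apply: measurableC.
apply: bigcupT_measurable_rat => q; apply: measurableC.
rewrite -[X in measurable X]setTI.
apply: emeasurable_fun_infty_c => //; apply: mc; exact: measurable_straddle.
Qed.

End Tilings.

(** * The random tessellations *)

(** A gap straddling q consists of the neighbours of q in Z, so there is at most
    one. *)
Lemma gaps_noncrossing (R : realType) (Phi : cluster_space R) (Z : set R) :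
  clusters Phi = gaps Z -> noncrossing Phi.
Proof.
move=> PhiE; split=> [/=|q _ /=].
  apply/eqP/negPn/negP => /counting_neq0[X []].
  rewrite PhiE => -[a [b [[_ _ ab _] ->]]].
  by rewrite /= cardfs2 (lt_eqF ab).
apply/counting_le1 => X Y; rewrite PhiE.
move=> [[a [b [cab ->]]] +] [[c [d [ccd ->]]] +].
have [_ _ ab _] := cab; have [_ _ cd _] := ccd.
move=> /(straddle_pair _ ab)/andP[aq qb] /(straddle_pair _ cd)/andP[cq qd].
rewrite -(pred_pt_consecutive (q := ratr q) cab) ?aq ?ltW//.
rewrite -(succ_pt_consecutive (q := ratr q) cab) ?qb ?ltW//.
rewrite (pred_pt_consecutive (q := ratr q) ccd) ?cq ?ltW//.
by rewrite (succ_pt_consecutive (q := ratr q) ccd) ?qd ?ltW.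
Qed.

(** A negligible set is one contained in a measurable null set; here this is the
    complement of [noncrossing], whose preimage is empty. *)
Lemma random_tessellation_of_surely d (S : measurableType d) (R : realType)
    (P : probability S R) (psi : {mfun S >-> cluster_space R}) :
  (forall x, noncrossing (psi x)) ->
  random_cluster_tessellation (distribution P psi).
Proof.
move=> npsi; exists (~` @noncrossing R); split.
- exact: measurableC (@measurable_noncrossing R).
- have E : psi @^-1` (~` @noncrossing R) = set0.
    by apply/seteqP; split=> x // /(_ (npsi x)).
  by rewrite -[LHS]/(P (psi @^-1` _)) E measure0.
- by move=> Phi nt nc; apply: nt; exact: noncrossing_tessellation.
Qed.

Theorem proposition6 (R : realType)
  (c : R) (c_gt0 : 0 < c)
  (rho : {measure set (R * R) -> \bar R})
  (rhoE : forall B, measurable B ->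
     rho B = (\esum_(e in @Lambda R) (c%:E * \d_e B))%E)
  (P_rho : probability (counting_space R) R)
  (P_rho_poisson : is_poisson_process rho P_rho)
  (eps : R) (eps_gt0 : 0 < eps)
  (eps_small : trivIset (@Lambda R) (cball eps))
  (P : probability (simple_space R) R) :
  exists (supp_map : {mfun counting_space R >-> simple_space R})
         (b_map : {mfun simple_space R >-> simple_space R})
         (psi_map : {mfun simple_space R >-> cluster_space R}),
    [/\ forall eta, points (supp_map eta) = supp eta,
        forall eta, points (b_map eta) = b_ eps eta,
        forall eta, clusters (psi_map eta) = psi_D_S eta,
        random_cluster_tessellation
          (distribution (distribution P_rho supp_map) psi_map) &
        random_cluster_tessellation
          (distribution (distribution P b_map) psi_map)].
Proof.
pose psi : {mfun simple_space R >-> cluster_space R} :=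
  mfun_Sub (mem_set (@measurable_psi_config R)).
have npsi eta : noncrossing (psi eta).
  by apply: (gaps_noncrossing (Z := shadow eta)); exact: psi_D_SE.
exists (mfun_Sub (mem_set (@measurable_supp_config R))).
exists (mfun_Sub (mem_set (measurable_b_config eps_gt0 eps_small))).
exists psi; split=> //; exact: random_tessellation_of_surely.
Qed.
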